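(* Let $T=3$ and suppose $\underline{C}\le\overline{V}<\underline{C}+V$, $\overline{C}-\overline{V}-V\ge 0$ and $\overline{C}-\underline{C}-2V\ge 0$. (i) If $L=1$ and $\ell=2$, then $\mathrm{conv}(P)$ is the set of all $(x_1,x_2,x_3,y_1,y_2,y_3,u_2,u_3)\in\mathbb{R}^8$ satisfying \begin{align*} & u_2\ge y_2-y_1,\quad u_3\ge y_3-y_2,\quad u_2\ge 0,\quad u_3\ge 0,\\ & x_1\ge\underline{C}y_1,\quad x_2\ge\underline{C}y_2,\quad x_3\ge\underline{C}y_3,\\ & u_2\le y_2,\quad u_3\le y_3,\quad y_1+u_2+u_3\le 1,\\ & x_1\le\overline{V}y_1+(\overline{C}-\overline{V})(y_2-u_2),\\ & x_1\le\overline{V}y_1+V(y_2-u_2)+(\overline{C}-\overline{V}-V)(y_3-u_3),\\ & x_2\le\overline{C}y_2-(\overline{C}-\overline{V})u_2,\\ & x_2\le\overline{V}y_2+(\overline{C}-\overline{V})(y_3-u_3),\\ & x_3\le\overline{C}y_3-(\overline{C}-\overline{V})u_3,\\ & x_3\le(\overline{V}+V)y_3-Vu_3+(\overline{C}-\overline{V}-V)(y_2-u_2),\\ & x_2-x_1\le\overline{V}y_2-\underline{C}y_1+(\underline{C}+V-\overline{V})(y_3-u_3),\\ & x_2-x_1\le(\underline{C}+V)y_2-\underline{C}y_1-(\underline{C}+V-\overline{V})u_2,\\ & x_3-x_2\le(\underline{C}+V)y_3-\underline{C}y_2-(\underline{C}+V-\overline{V})u_3,\\ & x_1-x_2\le\overline{V}y_1-(\overline{V}-V)y_2-(\underline{C}+V-\overline{V})u_2,\\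 & x_2-x_3\le\overline{V}y_2-(\overline{V}-V)y_3-(\underline{C}+V-\overline{V})u_3,\\ & x_2-x_3\le(\underline{C}+V)y_2-\underline{C}y_3-(\underline{C}+V-\overline{V})u_2,\\ & x_3-x_1\le(\underline{C}+2V)y_3-\underline{C}y_1-(\underline{C}+2V-\overline{V})u_3,\\ & x_3-x_1\le(\overline{V}+V)y_3-Vu_3-\underline{C}y_1+(\underline{C}+V-\overline{V})(y_2-u_2),\\ & x_1-x_3\le\overline{V}y_1-\underline{C}y_3+(\underline{C}+2V-\overline{V})(y_2-u_2),\\ & x_1-x_3\le\overline{V}y_1-\underline{C}y_3+V(y_2-u_2)+(\underline{C}+V-\overline{V})(y_3-u_3). \end{align*} (ii) If $L=2$ and $\ell=1$, then $\mathrm{conv}(P)$ is the set of all $(x_1,x_2,x_3,y_1,y_2,y_3,u_2,u_3)\in\mathbb{R}^8$ satisfying \begin{align*} & u_2+u_3\le y_3,\quad y_1+u_2\le 1,\quad y_2+u_3\le 1,\\ & u_2\ge y_2-y_1,\quad u_3\ge y_3-y_2,\quad u_2\ge 0,\quad u_3\ge 0,\\ & x_1\ge\underline{C}y_1,\quad x_2\ge\underline{C}y_2,\quad x_3\ge\underline{C}y_3,\\ & x_1\le\overline{V}y_1+V(y_2-u_2)+(\overline{C}-\overline{V}-V)(y_3-u_3-u_2),\\ & x_2\le\overline{V}y_2+(\overline{C}-\overline{V})(y_3-u_3-u_2),\\ & x_3\le\overline{C}y_3-(\overline{C}-\overline{V})u_3-(\overline{C}-\overline{V}-V)u_2,\\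 & x_2-x_1\le\overline{V}y_2-\underline{C}y_1+(\underline{C}+V-\overline{V})(y_3-u_3-u_2),\\ & x_3-x_2\le(\underline{C}+V)y_3-\underline{C}y_2-(\underline{C}+V-\overline{V})u_3,\\ & x_1-x_2\le\overline{V}y_1-(\overline{V}-V)y_2-(\underline{C}+V-\overline{V})u_2,\\ & x_2-x_3\le\overline{V}y_2-\underline{C}y_3+(\underline{C}+V-\overline{V})(y_3-u_3-u_2),\\ & x_3-x_1\le(\underline{C}+2V)y_3-\underline{C}y_1-(\underline{C}+2V-\overline{V})u_3-(\underline{C}+V-\overline{V})u_2,\\ & x_1-x_3\le\overline{V}y_1-\underline{C}y_3+V(y_2-u_2)+(\underline{C}+V-\overline{V})(y_3-u_3-u_2),\\ & x_1-x_2+x_3\le\overline{V}y_1-(\overline{V}-V)y_2+\overline{V}y_3+(\overline{C}-\overline{V})(y_3-u_3-u_2). \end{align*}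
   Context: $T$ is the number of time periods, $L,\ell$ are positive integers (minimum-up and minimum-down time), and $\underline{C},\overline{C},\overline{V},V$ are real parameters (generation lower bound, generation upper bound, start-up/shut-down ramp rate, ramp rate in the stable region) with $0\le\underline{C}\le\overline{V}\le\overline{C}$ and $V>0$. For integers $a,b$, $[a,b]_{\mathbb{Z}}$ is the set of integers $i$ with $a\le i\le b$. $P$ is the set of $(x,y,u)\in\mathbb{R}_+^T\times\{0,1\}^T\times\{0,1\}^{T-1}$, with $x=(x_1,\dots,x_T)$, $y=(y_1,\dots,y_T)$, $u=(u_2,\dots,u_T)$, such that \begin{align*} &\textstyle\sum_{i=t-L+1}^{t}u_i\le y_t,\ t\in[L+1,T]_{\mathbb{Z}};\qquad \sum_{i=t-\ell+1}^{t}u_i\le 1-y_{t-\ell},\ t\in[\ell+1,T]_{\mathbb{Z}};\\ &y_t-y_{t-1}-u_t\le 0,\ t\in[2,T]_{\mathbb{Z}};\qquad \underline{C}y_t\le x_t\le\overline{C}y_t,\ t\in[1,T]_{\mathbb{Z}};\\ &x_t-x_{t-1}\le Vy_{t-1}+\overline{V}(1-y_{t-1}),\ t\in[2,T]_{\mathbb{Z}};\qquad x_{t-1}-x_t\le Vy_t+\overline{V}(1-y_t),\ t\in[2,T]_{\mathbb{Z}}. \end{align*} $\mathrm{conv}(P)$ denotes the convex hull of $P$. *)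

(* Defs.v *)
From mathcomp Require Import all_boot all_order all_algebra.
From mathcomp Require Import all_classical all_reals.
From mathcomp Require Import convex.

Set Implicit Arguments.
Unset Strict Implicit.
Unset Printing Implicit Defensive.

Import Order.TTheory GRing.Theory Num.Theory.

Local Open Scope classical_set_scope.
Local Open Scope ring_scope.

Definition conv_hull (R : realType) (M : lmodType R) (A : set M) : set M :=
  smallest (@convex_set R M) A.

(* The k-th entry of a row vector, counting from 0 (and 0 if k is out of range;
   no constraint below reads an entry out of range). *)
Definition entry (R : realType) (n : nat) (v : 'rV[R]_n) (k : nat) : R :=
  if insub k is Some i then v ord0 i else 0.

Lemma entry_ord (R : realType) (n : nat) (v : 'rV[R]_n) (i : 'I_n) :
  entry v i = v ord0 i.
Proof. by rewrite /entry valK. Qed.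

(* The space R^T x R^T x R^(T-1) of the triples (x, y, u). *)
Definition xyu_space (R : realType) (T : nat) : lmodType R :=
  ('rV[R]_T * 'rV[R]_T * 'rV[R]_T.-1)%type.

(* The mathematical indices are x = (x_1, ..., x_T), y = (y_1, ..., y_T) and
   u = (u_2, ..., u_T), hence the shifts by 1 and 2. *)
Definition xc (R : realType) (T : nat) (p : xyu_space R T) (t : nat) : R :=
  entry p.1.1 (t - 1).

Definition yc (R : realType) (T : nat) (p : xyu_space R T) (t : nat) : R :=
  entry p.1.2 (t - 1).

Definition uc (R : realType) (T : nat) (p : xyu_space R T) (t : nat) : R :=
  entry p.2 (t - 2).

(* Feasible set of the single-generator unit commitment problem: T periods,
   minimum-up time L, minimum-down time l, generation bounds Cmin and Cmax,
   start-up/shut-down ramp rate Vbar, stable ramp rate V. *)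
Definition P (R : realType) (T L l : nat) (Cmin Cmax Vbar V : R) :
    set (xyu_space R T) :=
  [set p |
    let x := xc p in let y := yc p in let u := uc p in
    (forall t : nat, (1 <= t <= T)%N -> 0 <= x t)
    /\ (forall t : nat, (1 <= t <= T)%N -> y t = 0 \/ y t = 1)
    /\ (forall t : nat, (2 <= t <= T)%N -> u t = 0 \/ u t = 1)
    /\ (forall t : nat, (L + 1 <= t <= T)%N ->
          \sum_(t - L + 1 <= i < t.+1) u i <= y t)
    /\ (forall t : nat, (l + 1 <= t <= T)%N ->
          \sum_(t - l + 1 <= i < t.+1) u i <= 1 - y (t - l)%N)
    /\ (forall t : nat, (2 <= t <= T)%N -> y t - y (t - 1)%N - u t <= 0)
    /\ (forall t : nat, (1 <= t <= T)%N -> Cmin * y t <= x t <= Cmax * y t)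
    /\ (forall t : nat, (2 <= t <= T)%N ->
          x t - x (t - 1)%N <= V * y (t - 1)%N + Vbar * (1 - y (t - 1)%N))
    /\ (forall t : nat, (2 <= t <= T)%N ->
          x (t - 1)%N - x t <= V * y t + Vbar * (1 - y t))].

Arguments P {R} T%_nat_scope L%_nat_scope l%_nat_scope Cmin Cmax Vbar V _.

(* Main.v *)
(* With T = 3 and L + l = 3 there are only seven feasible commitments (y, u), and
   conv(P) is the set of all sums, over these commitments, of points of the
   corresponding dispatch polytopes scaled by weights that add up to 1.  The
   weights are determined by (y, u) up to one parameter.
   For L = 1, l = 2 the commitments of y = 111, 110, 100, 011, 010, 001 and 000
   satisfy 111 + 010 = 110 + 011; the dispatches allowed by the left-hand side
   contain those allowed by the right-hand side, so the weight of 111 can be taken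
   as large as possible, which is min(y2 - u2, y3 - u3).
   For L = 2, l = 1 the relation is 101 + 000 = 100 + 001 and the free weight does
   not influence the possible x.
   Once the weights are fixed, it remains to decompose x, which is a linear
   feasibility problem solved by Fourier-Motzkin elimination. *)
Require Import Defs.
From mathcomp Require Import all_boot all_order all_algebra.
From mathcomp Require Import all_classical all_reals.
From mathcomp Require Import convex interval_inference ring lra.

Import Order.TTheory GRing.Theory Num.Theory.

Local Open Scope classical_set_scope.
Local Open Scope ring_scope.

(** * Splitting a dispatch vector by Fourier-Motzkin elimination *)

(** One elimination step: comparing every lower bound with every upper bound suffices. The witness
    is 0, lowered to all upper bounds and then raised to all lower bounds. *)
Lemma exists_between (R : realDomainType) (ls us : seq R) :
  allrel <=%R ls us -> exists z, all (<= z) ls /\ all (>= z) us.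
Proof.
elim: ls => [|l ls IH] /=.
  move=> _; elim: us => [|u us [z [_ zus]]]; first by exists 0.
  exists (Num.min u z); split=> //=; rewrite ge_min lexx /=.
  by apply/allP=> v /(allP zus) zv; rewrite ge_min zv orbT.
rewrite allrel_consl => /andP[lus /IH [z [lsz zus]]].
exists (Num.max l z); split.
  rewrite /= le_max lexx /=.
  by apply/allP=> v /(allP lsz) /= vz; rewrite le_max vz orbT.
by apply/allP=> v vus /=; rewrite ge_max (allP lus _ vus) (allP zus _ vus).
Qed.

(* The shares in x of the commitments 111, 110 and 100 at time 1 or, after
   reversing time, of 111, 011 and 001 at time 3. *)
Lemma end_decomposition (R : realFieldType) (x Ka Va a2 Vb b2 pc : R) :
  0 <= Va -> 0 <= a2 <= Ka -> 0 <= Vb -> 0 <= b2 -> 0 <= pc -> 0 <= x ->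
  a2 <= x + Va -> x - Vb - pc - Ka <= b2 -> x - Vb - pc - Va <= a2 + b2 ->
  exists a1 b1 c1 : R, x = a1 + b1 + c1 /\
    [/\ 0 <= a1 <= Ka, a1 - a2 <= Va & a2 - a1 <= Va] /\
    [/\ 0 <= b1, b1 - b2 <= Vb & 0 <= c1 <= pc].
Proof.
move=> Va0 a20 Vb0 b20 pc0 x0 h1 h2 h3.
have [a1 [/= A1l A1u]] : exists z,
    all (<= z) [:: 0; a2 - Va; x - pc - Vb - b2] /\
    all (>= z) [:: Ka; x; a2 + Va].
  by apply: exists_between; rewrite /allrel /=; do !(apply/andP; split=> //); lra.
have [b1 [/= B1l B1u]] : exists z,
    all (<= z) [:: 0; x - a1 - pc] /\ all (>= z) [:: b2 + Vb; x - a1].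
  by apply: exists_between; rewrite /allrel /=; do !(apply/andP; split=> //); lra.
by exists a1, b1, (x - a1 - b1); do !split; lra.
Qed.

(* Here Cmin * y has been subtracted from x.  The letters a, ..., f refer to the
   commitments y = 111, 110, 100, 011, 010, 001, and K, V, p are the weight of such
   a commitment times Cmax - Cmin, V, Vbar - Cmin.  In the proof, the bounds listed
   for each unknown are those left by Fourier-Motzkin elimination of the unknowns
   chosen after it. *)
Lemma ramp_decomposition (R : realFieldType)
    (x1 x2 x3 Ka Va pb Vb pc pd Vd pe pf : R) :
  0 <= Va -> 2 * Va <= Ka ->
  0 <= pb -> pb <= Vb -> 0 <= pc -> 0 <= pd -> pd <= Vd -> 0 <= pe -> 0 <= pf ->
  0 <= x1 -> 0 <= x2 -> 0 <= x3 ->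
  x1 <= Ka + pb + Vb + pc ->
  x2 <= Ka + pb + pd + pe ->
  x3 <= Ka + pd + Vd + pf ->
  x1 - x2 <= Va + Vb + pc ->
  x2 - x1 <= Va + pb + pd + pe ->
  x3 - x2 <= Va + Vd + pf ->
  x2 - x3 <= Va + pb + pd + pe ->
  x1 - x3 <= 2 * Va + pb + Vb + pc ->
  x3 - x1 <= 2 * Va + pd + Vd + pf ->
  x1 - x2 + x3 <= Ka + Va + Vb + pc + Vd + pf ->
  exists a1 a2 a3 b1 b2 c1 d2 d3 e2 f3 : R,
    [/\ x1 = a1 + b1 + c1, x2 = a2 + b2 + d2 + e2 & x3 = a3 + d3 + f3] /\
    [/\ 0 <= a1 <= Ka, 0 <= a2 <= Ka & 0 <= a3 <= Ka] /\
    [/\ a1 - a2 <= Va, a2 - a1 <= Va, a2 - a3 <= Va & a3 - a2 <= Va] /\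
    [/\ 0 <= b2 <= pb, 0 <= b1 & b1 - b2 <= Vb] /\
    [/\ 0 <= d2 <= pd, 0 <= d3 & d3 - d2 <= Vd] /\
    [/\ 0 <= c1 <= pc, 0 <= e2 <= pe & 0 <= f3 <= pf].
Proof.
move=> Va0 VKa pb0 pbV pc0 pd0 pdV pe0 pf0 x10 x20 x30.
move=> h1 h2 h3 h12 h21 h32 h23 h13 h31 h123.
have [b2 [/= B2l B2u]] : exists z,
    all (<= z) [:: 0; x1 - Vb - pc - Ka; x1 - x3 - Vb - pc - 2 * Va;
      x2 - Ka - pe - pd; x2 - x1 - Va - pe - pd; x2 - x3 - Va - pe - pd] /\
    all (>= z) [:: pb; x2 - x3 + Vd + pf + Va; x2].
  by apply: exists_between; rewrite /allrel /=; do !(apply/andP; split=> //); lra.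
clear h1 h2 h21 h23 h13.
have [d2 [/= D2l D2u]] : exists z,
    all (<= z) [:: 0; x3 - Vd - pf - Ka; x3 - x1 - Vd - pf - 2 * Va;
      x2 - Ka - pe - b2; x2 - x1 - Va - pe - b2; x2 - x3 - Va - pe - b2] /\
    all (>= z) [:: pd; x2 - x1 + Vb + pc + Va; x2 - b2].
  by apply: exists_between; rewrite /allrel /=; do !(apply/andP; split=> //); lra.
clear h3 h12 h32 h31 h123.
have [e2 [/= E2l E2u]] : exists z,
    all (<= z) [:: 0; x2 - b2 - d2 - Ka; x2 - b2 - d2 - x1 - Va;
      x2 - b2 - d2 - x3 - Va] /\
    all (>= z) [:: pe; x2 - b2 - d2; x2 - x1 + Vb + pc + Va - d2;
      x2 - x3 + Vd + pf + Va - b2].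
  by apply: exists_between; rewrite /allrel /=; do !(apply/andP; split=> //); lra.
(* Given [b2], [d2] and [e2], the remainder [a2] is forced, and the problems for [x1] and [x3]
   become independent. The bounds stated for [a2] are those that [end_decomposition] asks for at
   either end. *)
have [a2 [x2E [Ha2 A21 A23] [A2b A2d]]] : exists a2,
    [/\ x2 = a2 + b2 + d2 + e2,
        [/\ 0 <= a2 <= Ka, a2 <= x1 + Va & a2 <= x3 + Va]
      & x1 - Vb - pc - Va <= a2 + b2 /\ x3 - Vd - pf - Va <= a2 + d2].
  by exists (x2 - b2 - d2 - e2); clear - E2l E2u; do !split; lra.
have {E2l E2u} He2 : 0 <= e2 <= pe by clear - E2l E2u; lra.
have [a1 [b1 [c1 [x1E [[Ha1 Ha12 Ha21] [Hb1 Hb12 Hc1]]]]]] :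
    exists a1 b1 c1 : R, x1 = a1 + b1 + c1 /\
    [/\ 0 <= a1 <= Ka, a1 - a2 <= Va & a2 - a1 <= Va] /\
    [/\ 0 <= b1, b1 - b2 <= Vb & 0 <= c1 <= pc].
  by apply: end_decomposition => //; clear - A2b B2l pb0 pbV; lra.
have [a3 [d3 [f3 [x3E [[Ha3 Ha32 Ha23] [Hd3 Hd32 Hf3]]]]]] :
    exists a3 d3 f3 : R, x3 = a3 + d3 + f3 /\
    [/\ 0 <= a3 <= Ka, a3 - a2 <= Va & a2 - a3 <= Va] /\
    [/\ 0 <= d3, d3 - d2 <= Vd & 0 <= f3 <= pf].
  by apply: end_decomposition => //; clear - A2d D2l pd0 pdV; lra.
exists a1, a2, a3, b1, b2, c1, d2, d3, e2, f3.
have {B2l B2u} Hb2 : 0 <= b2 <= pb by clear - B2l B2u; lra.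
have {D2l D2u} Hd2 : 0 <= d2 <= pd by clear - D2l D2u; lra.
by do 4?[split; first by []].
Qed.

(** * Weighted points of a convex set *)

(** The slice at height [w] of the cone over [A]. Carrying the weight along allows a convex
    combination to be built one summand at a time, zero weights included. *)
Definition weighted {R : realType} {M : lmodType R} (A : set M) (w : R) (v : M) :=
  0 <= w /\ exists2 q, A q & v = w *: q.

Lemma weighted1 (R : realType) (M : lmodType R) (A : set M) (v : M) :
  weighted A 1 v -> A v.
Proof. by case=> _ [q Aq ->]; rewrite scale1r. Qed.

(** The sum [w1 *: q1 + w2 *: q2] is [w1 + w2] times the convex combination of [q1] and [q2] with
    ratio [w1 / (w1 + w2)]. *)
Lemma weightedD (R : realType) (M : lmodType R) (A : set M) (w1 w2 : R)
    (v1 v2 : M) :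
  convex_set A -> weighted A w1 v1 -> weighted A w2 v2 ->
  weighted A (w1 + w2) (v1 + v2).
Proof.
move=> cA [w1_ge0 [q1 Aq1 ->]] [w2_ge0 [q2 Aq2 ->]]; split; first exact: addr_ge0.
have [w0|w_neq0] := eqVneq (w1 + w2) 0.
  (* Both vectors vanish here, so any point of [A] serves as base point. *)
  have [w1_0 w2_0] : w1 = 0 /\ w2 = 0 by split; lra.
  by exists q1; rewrite // w1_0 w2_0 !scale0r !addr0 scale0r.
have w_gt0 : 0 < w1 + w2 by rewrite lt_def w_neq0 addr_ge0.
have t_ge0 : 0 <= w1 / (w1 + w2) by rewrite divr_ge0// ltW.
have t_le1 : w1 / (w1 + w2) <= 1 by rewrite ler_pdivrMr// mul1r lerDl.
have /set_mem Aq := cA q1 q2 (Itv01 t_ge0 t_le1) (mem_set Aq1) (mem_set Aq2).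
eexists; first exact: Aq.
rewrite /conv /= scalerDr !scalerA; congr (_ *: _ + _ *: _).
  by rewrite mulrC divfK.
rewrite [RHS](_ : _ = (w1 + w2) * (1 - w1 / (w1 + w2)))//.
by rewrite mulrBr mulr1 [X in _ - X]mulrC divfK// addrAC subrr add0r.
Qed.

Arguments weightedD {R M A w1 w2 v1 v2}.

Lemma convex_conv_hull (R : realType) (M : lmodType R) (A : set M) :
  convex_set (conv_hull A).
Proof.
move=> p q t /set_mem Ap /set_mem Aq; apply/mem_set => B [cB AB].
by apply/set_mem/cB; apply/mem_set; [apply: Ap|apply: Aq].
Qed.

(** * Coordinates of the points for three periods *)

Definition schedule {R : realType} (x1 x2 x3 y1 y2 y3 u2 u3 : R) :
    xyu_space R 3 :=
  (\row_i [:: x1; x2; x3]`_i, \row_i [:: y1; y2; y3]`_i, \row_i [:: u2; u3]`_i).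

Lemma entry_row (R : realType) (n : nat) (s : seq R) (k : nat) :
  (k < n)%N -> entry (\row_(i < n) s`_i) k = s`_k.
Proof. by move=> kn; rewrite (entry_ord _ (Ordinal kn)) mxE. Qed.

Lemma row_entry (R : realType) (n : nat) (s : seq R) (v : 'rV[R]_n) :
  (forall k, (k < n)%N -> s`_k = entry v k) -> \row_(i < n) s`_i = v.
Proof. by move=> sv; apply/rowP => i; rewrite mxE sv// entry_ord. Qed.

Lemma scheduleK (R : realType) (p : xyu_space R 3) :
  schedule (xc p 1) (xc p 2) (xc p 3) (yc p 1) (yc p 2) (yc p 3)
    (uc p 2) (uc p 3) = p.
Proof.
rewrite /xc /yc /uc; case: p => [[x y] u].
by congr (_, _, _); apply: row_entry; do 3?[case=> //].
Qed.

Lemma schedule_coord (R : realType) (x1 x2 x3 y1 y2 y3 u2 u3 : R) :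
  let p := schedule x1 x2 x3 y1 y2 y3 u2 u3 in
  (((xc p 1 = x1) * (xc p 2 = x2) * (xc p 3 = x3)) *
   ((yc p 1 = y1) * (yc p 2 = y2) * (yc p 3 = y3)) *
   ((uc p 2 = u2) * (uc p 3 = u3)))%type.
Proof. by rewrite /xc /yc /uc /= !entry_row. Qed.

Lemma entryD (R : realType) (n : nat) (v w : 'rV[R]_n) (k : nat) :
  entry (v + w) k = entry v k + entry w k.
Proof. by rewrite /entry; case: insubP => [i _ _|_]; rewrite ?mxE ?addr0. Qed.

Lemma entryZ (R : realType) (n : nat) (a : R) (v : 'rV[R]_n) (k : nat) :
  entry (a *: v) k = a * entry v k.
Proof. by rewrite /entry; case: insubP => [i _ _|_]; rewrite ?mxE ?mulr0. Qed.

Lemma coordD (R : realType) (p q : xyu_space R 3) (t : nat) :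
  ((xc (p + q)%R t = xc p t + xc q t)%R * (yc (p + q)%R t = yc p t + yc q t)%R *
   (uc (p + q)%R t = uc p t + uc q t)%R)%type.
Proof. by rewrite /xc /yc /uc !entryD. Qed.

Lemma coordZ (R : realType) (a : R) (p : xyu_space R 3) (t : nat) :
  ((xc (a *: p)%R t = a * xc p t)%R * (yc (a *: p)%R t = a * yc p t)%R *
   (uc (a *: p)%R t = a * uc p t)%R)%type.
Proof. by rewrite /xc /yc /uc !entryZ. Qed.

Lemma scheduleD (R : realType) (x1 x2 x3 y1 y2 y3 u2 u3
    x1' x2' x3' y1' y2' y3' u2' u3' : R) :
  schedule x1 x2 x3 y1 y2 y3 u2 u3 + schedule x1' x2' x3' y1' y2' y3' u2' u3' =
  schedule (x1 + x1') (x2 + x2') (x3 + x3') (y1 + y1') (y2 + y2') (y3 + y3')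
    (u2 + u2') (u3 + u3').
Proof. by rewrite -[LHS]scheduleK !coordD !schedule_coord. Qed.

Lemma scheduleZ (R : realType) (a x1 x2 x3 y1 y2 y3 u2 u3 : R) :
  a *: schedule x1 x2 x3 y1 y2 y3 u2 u3 =
  schedule (a * x1) (a * x2) (a * x3) (a * y1) (a * y2) (a * y3)
    (a * u2) (a * u3).
Proof. by rewrite -[LHS]scheduleK !coordZ !schedule_coord. Qed.

Lemma schedule0 (R : realType) :
  schedule 0 0 0 0 0 0 0 0 = 0 :> xyu_space R 3.
Proof. by rewrite -[RHS](scale0r (schedule 0 0 0 0 0 0 0 0)) scheduleZ !mul0r. Qed.

(** * Feasibility as a commitment together with a dispatch *)

Definition binary {R : realType} (a : R) := a = 0 \/ a = 1.

(* x lies in w times the set of dispatches that are feasible for the fixed y. *)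
Definition dispatch {R : realType} (Cmin Cmax Vbar V w x1 x2 x3 y1 y2 y3 : R) :=
  [/\ w * (Cmin * y1) <= x1 <= w * (Cmax * y1),
      w * (Cmin * y2) <= x2 <= w * (Cmax * y2)
    & w * (Cmin * y3) <= x3 <= w * (Cmax * y3)] /\
  [/\ x2 - x1 <= w * (V * y1 + Vbar * (1 - y1)),
      x3 - x2 <= w * (V * y2 + Vbar * (1 - y2)),
      x1 - x2 <= w * (V * y2 + Vbar * (1 - y2))
    & x2 - x3 <= w * (V * y3 + Vbar * (1 - y3))].

(* a, ..., f are the weights of the commitments y = 111, 110, 100, 011, 010, 001. *)
Definition dispatch_sum {R : realType}
    (Cmin Cmax Vbar V x1 x2 x3 a b c d e f : R) :=
  exists a1 a2 a3 b1 b2 c1 d2 d3 e2 f3 : R,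
    [/\ x1 = a1 + b1 + c1, x2 = a2 + b2 + d2 + e2 & x3 = a3 + d3 + f3] /\
    [/\ dispatch Cmin Cmax Vbar V a a1 a2 a3 1 1 1,
        dispatch Cmin Cmax Vbar V b b1 b2 0 1 1 0
      & dispatch Cmin Cmax Vbar V c c1 0 0 1 0 0] /\
    [/\ dispatch Cmin Cmax Vbar V d 0 d2 d3 0 1 1,
        dispatch Cmin Cmax Vbar V e 0 e2 0 0 1 0
      & dispatch Cmin Cmax Vbar V f 0 0 f3 0 0 1].

(** The constraints on y and u that are common to all minimum up and down times; [up_down] collects
    those that depend on [L] and [l]. *)
Definition commitment {R : realType} (y1 y2 y3 u2 u3 : R) :=
  [/\ binary y1, binary y2, binary y3, binary u2 & binary u3] /\
  (y2 - y1 <= u2 /\ y3 - y2 <= u3).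

Definition up_down {R : realType} (L l : nat) (p : xyu_space R 3) :=
  (forall t : nat, (L + 1 <= t <= 3)%N ->
     \sum_(t - L + 1 <= i < t.+1) uc p i <= yc p t) /\
  (forall t : nat, (l + 1 <= t <= 3)%N ->
     \sum_(t - l + 1 <= i < t.+1) uc p i <= 1 - yc p (t - l)%N).

(** Here [0 <= Cmin] and the lower generation bounds supply the sign constraints on x; the other
    constraints of [P] are regrouped period by period. *)
Lemma P3E (R : realType) (Cmin Cmax Vbar V : R) (L l : nat)
    (p : xyu_space R 3) : 0 <= Cmin ->
  P 3 L l Cmin Cmax Vbar V p <->
  [/\ commitment (yc p 1) (yc p 2) (yc p 3) (uc p 2) (uc p 3),
      up_down L l p
    & dispatch Cmin Cmax Vbar V 1 (xc p 1) (xc p 2) (xc p 3)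
        (yc p 1) (yc p 2) (yc p 3)].
Proof.
move=> hCmin; rewrite /commitment /dispatch !mul1r; split.
  move=> [_ [y01 [u01 [up [down [start [gen [rup rdown]]]]]]]].
  have := (start 2 isT, start 3 isT); rewrite !subr_le0 => -[start2 start3].
  split=> //.
    by split=> //; split;
      [exact: y01|exact: y01|exact: y01|exact: u01|exact: u01].
  split; split; [exact: gen|exact: gen|exact: gen|exact: (rup 2)|exact: (rup 3)|
    exact: (rdown 2)|exact: (rdown 3)].
move=> [[[y01 y02 y03 u02 u03] [start2 start3]] [up down]].
move=> [[g1 g2 g3] [r2 r3 r2' r3']].
have x_ge0 (x y : R) : binary y -> Cmin * y <= x <= Cmax * y -> 0 <= x.
  move=> [|] -> /andP[+ _]; first by rewrite mulr0.
  by rewrite mulr1; apply: le_trans.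
split.
  by do 4?[case=> //] => _; [exact: x_ge0 g1|exact: x_ge0 g2|exact: x_ge0 g3].
split; first by do 4?[case=> //].
split; first by do 4?[case=> //].
split=> //; split=> //.
split; first by do 4?[case=> //] => _; rewrite subr_le0.
split; first by do 4?[case=> //].
by split; do 4?[case=> //].
Qed.

Arguments P3E {R Cmin Cmax Vbar V L l p}.

Lemma up_down12 (R : realType) (p : xyu_space R 3) :
  up_down 1 2 p <->
  [/\ uc p 2 <= yc p 2, uc p 3 <= yc p 3 & uc p 2 + uc p 3 <= 1 - yc p 1].
Proof.
split=> [[up down]|[up2 up3 down]].
  have := (up 2 isT, up 3 isT, down 3 isT).
  by rewrite !big_nat1 big_ltn// big_nat1 /= => -[[]].
split; first by do 4?[case=> //] => _; rewrite big_nat1.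
by do 4?[case=> //] => _; rewrite big_ltn// big_nat1.
Qed.

Lemma up_down21 (R : realType) (p : xyu_space R 3) :
  up_down 2 1 p <->
  [/\ uc p 2 + uc p 3 <= yc p 3, uc p 2 <= 1 - yc p 1 & uc p 3 <= 1 - yc p 2].
Proof.
split=> [[up down]|[up down2 down3]].
  have := (up 3 isT, down 2 isT, down 3 isT).
  by rewrite !big_nat1 big_ltn// big_nat1 /= => -[[]].
split; first by do 4?[case=> //] => _; rewrite big_ltn// big_nat1.
by do 4?[case=> //] => _; rewrite big_nat1.
Qed.

(** For [w > 0], dividing x by [w] gives a point of [P]. For [w = 0] the generation bounds force x
    to be 0, and the zero schedule, which is feasible, is the base point. *)
Lemma weighted_dispatch (R : realType) (Cmin Cmax Vbar V : R) (L l : nat)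
    (w x1 x2 x3 y1 y2 y3 u2 u3 : R) :
  0 <= Cmin -> 0 <= Vbar -> 0 <= w ->
  commitment y1 y2 y3 u2 u3 ->
  (forall x1 x2 x3, up_down L l (schedule x1 x2 x3 y1 y2 y3 u2 u3)) ->
  up_down L l (0 : xyu_space R 3) ->
  dispatch Cmin Cmax Vbar V w x1 x2 x3 y1 y2 y3 ->
  weighted (conv_hull (P 3 L l Cmin Cmax Vbar V)) w
    (schedule x1 x2 x3 (w * y1) (w * y2) (w * y3) (w * u2) (w * u3)).
Proof.
move=> Cmin0 Vbar0 w0 cyu udyu ud0 dw; split=> //.
have sub := @sub_gen_smallest _ (@convex_set R (xyu_space R 3))
  (P 3 L l Cmin Cmax Vbar V).
have [w_eq0|w_neq0] := eqVneq w 0.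
  exists 0.
    apply: sub; apply/P3E => //.
    rewrite -schedule0 in ud0 *.
    rewrite !schedule_coord; split=> //.
      by do !split; rewrite ?subrr //; left.
    by do !split; lra.
  move: dw; rewrite w_eq0 scale0r -schedule0 /dispatch !mul0r => -[[h1 h2 h3] _].
  by congr schedule; lra.
have w_gt0 : 0 < w by rewrite lt_def w_neq0.
exists (schedule (x1 / w) (x2 / w) (x3 / w) y1 y2 y3 u2 u3); last first.
  by rewrite scheduleZ; congr schedule; rewrite mulrC divfK.
apply: sub; apply/P3E => //; rewrite !schedule_coord; split=> //.
move: dw; rewrite /dispatch !mul1r -!mulrBl !ler_pdivlMr// !ler_pdivrMr//.
by rewrite ![w * _]mulrC.
Qed.

Ltac lra_from h := move: h; clear; lra.

(** * Linear conditions for splitting x with given weights *)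

(** Each bound compares a linear form in x with the sum, over the six commitments, of the weight
    times the extreme value of that form on the dispatch polytope. Such bounds are clearly
    necessary; their sufficiency is [ramp_decomposition] after the shift by [Cmin]. *)
Lemma dispatch_decomposition (R : realType) (Cmin Cmax Vbar V : R)
    (x1 x2 x3 a b c d e f : R) :
  0 <= Cmin -> Cmin <= Vbar -> 0 < V -> Vbar < Cmin + V ->
  0 <= Cmax - Vbar - V -> 0 <= Cmax - Cmin - 2 * V ->
  0 <= a -> 0 <= b -> 0 <= c -> 0 <= d -> 0 <= e -> 0 <= f ->
  Cmin * (a + b + c) <= x1 ->
  Cmin * (a + b + d + e) <= x2 ->
  Cmin * (a + d + f) <= x3 ->
  x1 <= Cmax * a + (Vbar + V) * b + Vbar * c ->
  x2 <= Cmax * a + Vbar * (b + d + e) ->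
  x3 <= Cmax * a + (Vbar + V) * d + Vbar * f ->
  x1 - x2 <= V * (a + b) + Vbar * c - Cmin * (d + e) ->
  x2 - x1 <= V * a + (Vbar - Cmin) * b + Vbar * (d + e) - Cmin * c ->
  x3 - x2 <= V * (a + d) + Vbar * f - Cmin * (b + e) ->
  x2 - x3 <= V * a + (Vbar - Cmin) * d + Vbar * (b + e) - Cmin * f ->
  x1 - x3 <= 2 * V * a + (Vbar + V) * b + Vbar * c - Cmin * (d + f) ->
  x3 - x1 <= 2 * V * a + (Vbar + V) * d + Vbar * f - Cmin * (b + c) ->
  x1 - x2 + x3 <=
    (Cmax + V) * a + V * (b + d) + Vbar * (c + f) - Cmin * e ->
  dispatch_sum Cmin Cmax Vbar V x1 x2 x3 a b c d e f.
Proof.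
move=> Cmin0 CminVbar V0 VbarV CmaxVbar CmaxV a0 b0 c0 d0 e0 f0.
move=> l1 l2 l3 h1 h2 h3 h12 h21 h32 h23 h13 h31 h123.
have V_ge0 := ltW V0.
have p_ge0 : 0 <= Vbar - Cmin by rewrite subr_ge0.
have q_ge0 : 0 <= Cmin + V - Vbar by rewrite subr_ge0 ltW.
(* Products of a parameter and a weight are nonlinear; once their signs are recorded, the remaining
   arguments are linear in these products. *)
have facts w : 0 <= w -> [/\ 0 <= Cmin * w, 0 <= V * w, 0 <= (Vbar - Cmin) * w,
    0 <= (Cmin + V - Vbar) * w & 0 <= (Cmax - Vbar - V) * w] /\
    0 <= (Cmax - Cmin - 2 * V) * w.
  by move=> w0; do !split; exact: mulr_ge0.
have [[Ca Va pa qa Ka] Ka'] := facts a a0.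
have [[Cb Vb pb qb Kb] Kb'] := facts b b0.
have [[Cc Vc pc qc Kc] Kc'] := facts c c0.
have [[Cd Vd pd qd Kd] Kd'] := facts d d0.
have [[Ce Ve pe qe Ke] Ke'] := facts e e0.
have [[Cf Vf pf qf Kf] Kf'] := facts f f0.
have := @ramp_decomposition R
  (x1 - Cmin * (a + b + c)) (x2 - Cmin * (a + b + d + e))
  (x3 - Cmin * (a + d + f)) ((Cmax - Cmin) * a) (V * a)
  ((Vbar - Cmin) * b) (V * b) ((Vbar - Cmin) * c) ((Vbar - Cmin) * d) (V * d)
  ((Vbar - Cmin) * e) ((Vbar - Cmin) * f).
case=> //;
  [ by clear - Ka'; lra | by clear - qb; lra | by clear - qd; lra
  | by lra_from l1 | by lra_from l2 | by lra_from l3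
  | by lra_from h1 | by lra_from h2 | by lra_from h3
  | by lra_from h12 | by lra_from h21 | by lra_from h32 | by lra_from h23
  | by lra_from h13 | by lra_from h31 | by lra_from h123 | ].
move=> a1 [a2 [a3 [b1 [b2 [c1 [d2 [d3 [e2 [f3 [[X1 X2 X3]]]]]]]]]]].
move=> [[A1 A2 A3] [[A12 A21 A23 A32] [[B2 B1 B12] [[D2 D3 D32] [C1 E2 F3]]]]].
(* Undo the shift: each share regains [Cmin] times its weight in every period where its commitment
   is on. *)
exists (a1 + Cmin * a), (a2 + Cmin * a), (a3 + Cmin * a),
  (b1 + Cmin * b), (b2 + Cmin * b), (c1 + Cmin * c), (d2 + Cmin * d),
  (d3 + Cmin * d), (e2 + Cmin * e), (f3 + Cmin * f).
split; first by clear - X1 X2 X3; split; lra.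
clear facts X1 X2 X3 l1 l2 l3 h1 h2 h3 h12 h21 h32 h23 h13 h31 h123.
split; split.
- by clear - A1 A2 A3 A12 A21 A23 A32 Ca Va pa qa Ka; split; split; lra.
- by clear - B1 B2 B12 Cb Vb pb qb Kb; split; split; lra.
- by clear - C1 Cc Vc pc qc Kc; split; split; lra.
- by clear - D2 D3 D32 Cd Vd pd qd Kd; split; split; lra.
- by clear - E2 Ce Ve pe qe Ke; split; split; lra.
- by clear - F3 Cf Vf pf qf Kf; split; split; lra.
Qed.

Ltac solve_commitment :=
  split; [by split; by [left|right] | clear; split; lra].

Lemma dispatch0 (R : realType) (Cmin Cmax Vbar V w : R) :
  0 <= w -> 0 <= Vbar -> dispatch Cmin Cmax Vbar V w 0 0 0 0 0 0.
Proof. by move=> w0 /(mulr_ge0 w0) wVbar; split; split; lra. Qed.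

(** * From decomposed dispatches to points of the convex hull *)

Lemma conv_hull12 (R : realType) (Cmin Cmax Vbar V : R)
    (x1 x2 x3 a b c d e f : R) :
  0 <= Cmin -> Cmin <= Vbar ->
  0 <= a -> 0 <= b -> 0 <= c -> 0 <= d -> 0 <= e -> 0 <= f ->
  a + b + c + d + e + f <= 1 ->
  dispatch_sum Cmin Cmax Vbar V x1 x2 x3 a b c d e f ->
  conv_hull (P 3 1 2 Cmin Cmax Vbar V)
    (schedule x1 x2 x3 (a + b + c) (a + b + d + e) (a + d + f) (d + e) f).
Proof.
move=> Cmin0 CminVbar a0 b0 c0 d0 e0 f0 le1.
have Vbar0 := le_trans Cmin0 CminVbar.
move=> [a1 [a2 [a3 [b1 [b2 [c1 [d2 [d3 [e2 [f3 [[-> -> ->]]]]]]]]]]]].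
move=> [[A B C] [D E F]].
(* The commitment 000 receives the weight that the other six leave over. *)
have o0 : 0 <= 1 - (a + b + c + d + e + f) by rewrite subr_ge0.
have O : dispatch Cmin Cmax Vbar V (1 - (a + b + c + d + e + f)) 0 0 0 0 0 0.
  exact: dispatch0.
have cvx := @convex_conv_hull R (xyu_space R 3) (P 3 1 2 Cmin Cmax Vbar V).
have piece w z1 z2 z3 y1 y2 y3 u2 u3 : 0 <= w ->
    dispatch Cmin Cmax Vbar V w z1 z2 z3 y1 y2 y3 ->
    commitment y1 y2 y3 u2 u3 ->
    [/\ u2 <= y2, u3 <= y3 & u2 + u3 <= 1 - y1] ->
    weighted (conv_hull (P 3 1 2 Cmin Cmax Vbar V)) w
      (schedule z1 z2 z3 (w * y1) (w * y2) (w * y3) (w * u2) (w * u3)).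
  move=> w0 dw cyu udyu; apply: weighted_dispatch => //.
    by move=> ? ? ?; apply/up_down12; rewrite !schedule_coord.
  by rewrite -schedule0; apply/up_down12; rewrite !schedule_coord; split; lra.
(* The two explicit numbers are [u2] and [u3]: 011 and 010 start in period 2, 001 starts in period
   3, and the others have no start. *)
have {A}wA := piece _ _ _ _ _ _ _ 0 0 a0 A
  ltac:(solve_commitment) ltac:(clear; split; lra).
have {B}wB := piece _ _ _ _ _ _ _ 0 0 b0 B
  ltac:(solve_commitment) ltac:(clear; split; lra).
have {C}wC := piece _ _ _ _ _ _ _ 0 0 c0 C
  ltac:(solve_commitment) ltac:(clear; split; lra).
have {D}wD := piece _ _ _ _ _ _ _ 1 0 d0 D
  ltac:(solve_commitment) ltac:(clear; split; lra).
have {E}wE := piece _ _ _ _ _ _ _ 1 0 e0 E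
  ltac:(solve_commitment) ltac:(clear; split; lra).
have {F}wF := piece _ _ _ _ _ _ _ 0 1 f0 F
  ltac:(solve_commitment) ltac:(clear; split; lra).
have {O}wO := piece _ _ _ _ _ _ _ 0 0 o0 O
  ltac:(solve_commitment) ltac:(clear; split; lra).
apply: weighted1.
have := weightedD cvx wA wB.
move=> /(weightedD cvx) /(_ wC) /(weightedD cvx) /(_ wD) /(weightedD cvx) /(_ wE).
move=> /(weightedD cvx) /(_ wF) /(weightedD cvx) /(_ wO).
by rewrite !scheduleD [X in weighted _ X]addrC subrK !(mulr1, mulr0, addr0, add0r).
Qed.

Lemma dispatchZ (R : realType) (Cmin Cmax Vbar V k w x1 x2 x3 y1 y2 y3 : R) :
  0 <= k -> dispatch Cmin Cmax Vbar V w x1 x2 x3 y1 y2 y3 ->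
  dispatch Cmin Cmax Vbar V (k * w) (k * x1) (k * x2) (k * x3) y1 y2 y3.
Proof.
move=> k0 [[/andP[h1 h1'] /andP[h2 h2'] /andP[h3 h3']] [r1 r2 r3 r4]].
by split; split; rewrite -?mulrBr -!mulrA !ler_wpM2l.
Qed.

Arguments dispatchZ {R Cmin Cmax Vbar V k w x1 x2 x3 y1 y2 y3}.

(** The factor is [g / c]; for [c = 0] also [g = 0], and 0 is taken. *)
Lemma scale_between (R : realFieldType) (g c : R) :
  0 <= g <= c -> exists2 k, 0 <= k <= 1 & k * c = g.
Proof.
move=> /andP[g0 gc]; have [c0|c_neq0] := eqVneq c 0.
  by exists 0; [rewrite lexx ler01|lra].
have c_gt0 : 0 < c by rewrite lt_def c_neq0 (le_trans g0 gc).
exists (g / c); last by rewrite divfK.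
by rewrite (divr_ge0 g0 (ltW c_gt0)) ler_pdivrMr// mul1r.
Qed.

(** The five weights may add up to more than 1. Merging weight [g] of 100 with weight [g] of 001
    into 101 lowers the total by [g], and the two bounds on partial sums say that the excess over 1
    is at most [f] and at most [c]. *)
Lemma conv_hull21 (R : realType) (Cmin Cmax Vbar V : R)
    (x1 x2 x3 a b c d f : R) :
  0 <= Cmin -> Cmin <= Vbar -> 0 < V ->
  0 <= a -> 0 <= b -> 0 <= c -> 0 <= d -> 0 <= f ->
  a + b + c + d <= 1 -> a + b + d + f <= 1 ->
  dispatch_sum Cmin Cmax Vbar V x1 x2 x3 a b c d 0 f ->
  conv_hull (P 3 2 1 Cmin Cmax Vbar V)
    (schedule x1 x2 x3 (a + b + c) (a + b + d) (a + d + f) d f).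
Proof.
move=> Cmin0 CminVbar V0 a0 b0 c0 d0 f0 le1 le1'.
have Vbar0 := le_trans Cmin0 CminVbar.
move=> [a1 [a2 [a3 [b1 [b2 [c1 [d2 [d3 [e2 [f3 [[-> -> ->]]]]]]]]]]]].
move=> [[A B C] [D [[_ E2 _] _] F]].
(* The commitment 010 violates the minimum-up time 2; its weight 0 makes its share vanish. *)
have {E2}-> : e2 = 0 by lra.
(* g is the weight of y = 101, taken from those of 100 and 001. *)
have [g [/= gl gu]] : exists g,
    all (<= g) [:: 0; a + b + c + d + f - 1] /\ all (>= g) [:: c; f].
  by apply: exists_between; rewrite /allrel /=; do !(apply/andP; split=> //); lra.
have g0 : 0 <= g by lra.
(* The fractions [k] of the share of 100 and [l] of the share of 001 pass to 101, each carrying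
   weight [g]. *)
have [k /andP[k0 k1] kc] := @scale_between _ g c ltac:(lra).
have [l /andP[l0 l1] lf] := @scale_between _ g f ltac:(lra).
(* With the unit off in period 2, the limits on [x1] and on [x3] are independent, so any dispatch of
   100 combines with any dispatch of 001. *)
have G : dispatch Cmin Cmax Vbar V g (k * c1) 0 (l * f3) 1 0 1.
  have := dispatchZ l0 F.
  have := dispatchZ k0 C.
  rewrite kc lf /dispatch !mulr0; clear - g0 Cmin0 Vbar0 V0.
  move=> -[[C1 _ _] [C2 C3 C4 C5]] [[_ _ F1] [F2 F3 F4 F5]].
  have := mulr_ge0 g0 (ltW V0); have := mulr_ge0 g0 Cmin0.
  by move=> *; split; split; lra.
have kC : 0 <= 1 - k by rewrite subr_ge0.
have lC : 0 <= 1 - l by rewrite subr_ge0.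
have := dispatchZ kC C; rewrite !mulr0 => {}C.
have := dispatchZ lC F; rewrite !mulr0 => {}F.
have o0 : 0 <= 1 - (a + b + (1 - k) * c + d + (1 - l) * f + g) by lra.
have kc0 : 0 <= (1 - k) * c by exact: mulr_ge0.
have lf0 : 0 <= (1 - l) * f by exact: mulr_ge0.
have O : dispatch Cmin Cmax Vbar V
    (1 - (a + b + (1 - k) * c + d + (1 - l) * f + g)) 0 0 0 0 0 0.
  exact: dispatch0.
have cvx := @convex_conv_hull R (xyu_space R 3) (P 3 2 1 Cmin Cmax Vbar V).
have piece w z1 z2 z3 y1 y2 y3 u2 u3 : 0 <= w ->
    dispatch Cmin Cmax Vbar V w z1 z2 z3 y1 y2 y3 ->
    commitment y1 y2 y3 u2 u3 ->
    [/\ u2 + u3 <= y3, u2 <= 1 - y1 & u3 <= 1 - y2] ->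
    weighted (conv_hull (P 3 2 1 Cmin Cmax Vbar V)) w
      (schedule z1 z2 z3 (w * y1) (w * y2) (w * y3) (w * u2) (w * u3)).
  move=> w0 dw cyu udyu; apply: weighted_dispatch => //.
    by move=> ? ? ?; apply/up_down21; rewrite !schedule_coord.
  by rewrite -schedule0; apply/up_down21; rewrite !schedule_coord; split; lra.
have {A}wA := piece _ _ _ _ _ _ _ 0 0 a0 A
  ltac:(solve_commitment) ltac:(clear; split; lra).
have {B}wB := piece _ _ _ _ _ _ _ 0 0 b0 B
  ltac:(solve_commitment) ltac:(clear; split; lra).
have {C}wC := piece _ _ _ _ _ _ _ 0 0 kc0 C
  ltac:(solve_commitment) ltac:(clear; split; lra).
have {D}wD := piece _ _ _ _ _ _ _ 1 0 d0 D
  ltac:(solve_commitment) ltac:(clear; split; lra).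
have {F}wF := piece _ _ _ _ _ _ _ 0 1 lf0 F
  ltac:(solve_commitment) ltac:(clear; split; lra).
have {G}wG := piece _ _ _ _ _ _ _ 0 1 g0 G
  ltac:(solve_commitment) ltac:(clear; split; lra).
have {O}wO := piece _ _ _ _ _ _ _ 0 0 o0 O
  ltac:(solve_commitment) ltac:(clear; split; lra).
apply: weighted1.
have := weightedD cvx wA wB.
move=> /(weightedD cvx) /(_ wC) /(weightedD cvx) /(_ wD) /(weightedD cvx) /(_ wF).
move=> /(weightedD cvx) /(_ wG) /(weightedD cvx) /(_ wO).
rewrite !scheduleD [X in weighted _ X]addrC subrK !(mulr1, mulr0, addr0, add0r).
by congr (weighted _ _ _); congr schedule; clear - kc lf; lra.
Qed.

(** * The two inequality systems and their convexity *)

Definition facets12 {R : realType}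
    (Cmin Cmax Vbar V x1 x2 x3 y1 y2 y3 u2 u3 : R) : Prop :=
  (y2 - y1 <= u2 /\ y3 - y2 <= u3 /\ 0 <= u2 /\ 0 <= u3)
  /\ (Cmin * y1 <= x1 /\ Cmin * y2 <= x2 /\ Cmin * y3 <= x3)
  /\ (u2 <= y2 /\ u3 <= y3 /\ y1 + u2 + u3 <= 1)
  /\ x1 <= Vbar * y1 + (Cmax - Vbar) * (y2 - u2)
  /\ x1 <= Vbar * y1 + V * (y2 - u2) + (Cmax - Vbar - V) * (y3 - u3)
  /\ x2 <= Cmax * y2 - (Cmax - Vbar) * u2
  /\ x2 <= Vbar * y2 + (Cmax - Vbar) * (y3 - u3)
  /\ x3 <= Cmax * y3 - (Cmax - Vbar) * u3
  /\ x3 <= (Vbar + V) * y3 - V * u3 + (Cmax - Vbar - V) * (y2 - u2)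
  /\ x2 - x1 <= Vbar * y2 - Cmin * y1 + (Cmin + V - Vbar) * (y3 - u3)
  /\ x2 - x1 <= (Cmin + V) * y2 - Cmin * y1 - (Cmin + V - Vbar) * u2
  /\ x3 - x2 <= (Cmin + V) * y3 - Cmin * y2 - (Cmin + V - Vbar) * u3
  /\ x1 - x2 <= Vbar * y1 - (Vbar - V) * y2 - (Cmin + V - Vbar) * u2
  /\ x2 - x3 <= Vbar * y2 - (Vbar - V) * y3 - (Cmin + V - Vbar) * u3
  /\ x2 - x3 <= (Cmin + V) * y2 - Cmin * y3 - (Cmin + V - Vbar) * u2
  /\ x3 - x1 <=
       (Cmin + 2 * V) * y3 - Cmin * y1 - (Cmin + 2 * V - Vbar) * u3
  /\ x3 - x1 <=
       (Vbar + V) * y3 - V * u3 - Cmin * y1 + (Cmin + V - Vbar) * (y2 - u2)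
  /\ x1 - x3 <= Vbar * y1 - Cmin * y3 + (Cmin + 2 * V - Vbar) * (y2 - u2)
  /\ x1 - x3 <=
       Vbar * y1 - Cmin * y3 + V * (y2 - u2)
       + (Cmin + V - Vbar) * (y3 - u3).

Definition facets21 {R : realType}
    (Cmin Cmax Vbar V x1 x2 x3 y1 y2 y3 u2 u3 : R) : Prop :=
  (u2 + u3 <= y3 /\ y1 + u2 <= 1 /\ y2 + u3 <= 1)
  /\ (y2 - y1 <= u2 /\ y3 - y2 <= u3 /\ 0 <= u2 /\ 0 <= u3)
  /\ (Cmin * y1 <= x1 /\ Cmin * y2 <= x2 /\ Cmin * y3 <= x3)
  /\ x1 <= Vbar * y1 + V * (y2 - u2) + (Cmax - Vbar - V) * (y3 - u3 - u2)
  /\ x2 <= Vbar * y2 + (Cmax - Vbar) * (y3 - u3 - u2)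
  /\ x3 <= Cmax * y3 - (Cmax - Vbar) * u3 - (Cmax - Vbar - V) * u2
  /\ x2 - x1 <= Vbar * y2 - Cmin * y1 + (Cmin + V - Vbar) * (y3 - u3 - u2)
  /\ x3 - x2 <= (Cmin + V) * y3 - Cmin * y2 - (Cmin + V - Vbar) * u3
  /\ x1 - x2 <= Vbar * y1 - (Vbar - V) * y2 - (Cmin + V - Vbar) * u2
  /\ x2 - x3 <= Vbar * y2 - Cmin * y3 + (Cmin + V - Vbar) * (y3 - u3 - u2)
  /\ x3 - x1 <=
       (Cmin + 2 * V) * y3 - Cmin * y1 - (Cmin + 2 * V - Vbar) * u3
       - (Cmin + V - Vbar) * u2
  /\ x1 - x3 <=
       Vbar * y1 - Cmin * y3 + V * (y2 - u2)
       + (Cmin + V - Vbar) * (y3 - u3 - u2)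
  /\ x1 - x2 + x3 <=
       Vbar * y1 - (Vbar - V) * y2 + Vbar * y3
       + (Cmax - Vbar) * (y3 - u3 - u2).

Lemma conv_hull_sub (R : realType) (A : set (xyu_space R 3))
    (Q : R -> R -> R -> R -> R -> R -> R -> R -> Prop) (p : xyu_space R 3) :
  (forall t x1 x2 x3 y1 y2 y3 u2 u3 x1' x2' x3' y1' y2' y3' u2' u3' : R,
    0 <= t <= 1 -> Q x1 x2 x3 y1 y2 y3 u2 u3 ->
    Q x1' x2' x3' y1' y2' y3' u2' u3' ->
    Q (t * x1 + (1 - t) * x1') (t * x2 + (1 - t) * x2')
      (t * x3 + (1 - t) * x3') (t * y1 + (1 - t) * y1')
      (t * y2 + (1 - t) * y2') (t * y3 + (1 - t) * y3')
      (t * u2 + (1 - t) * u2') (t * u3 + (1 - t) * u3')) ->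
  (forall q, A q -> Q (xc q 1) (xc q 2) (xc q 3) (yc q 1) (yc q 2) (yc q 3)
                      (uc q 2) (uc q 3)) ->
  conv_hull A p ->
  Q (xc p 1) (xc p 2) (xc p 3) (yc p 1) (yc p 2) (yc p 3) (uc p 2) (uc p 3).
Proof.
move=> Qconv AQ; move: p; apply: smallest_sub => //.
move=> p q t /set_mem Qp /set_mem Qq; apply/mem_set; rewrite /= in Qp Qq *.
(* The abstract convex combination is by definition the usual one. *)
have -> : (conv t (p : convex_lmodType (xyu_space R 3)) q : xyu_space R 3) =
  t%:num *: p + (1 - t%:num) *: q by [].
by rewrite !coordD !coordZ; apply: Qconv => //; apply/andP; split.
Qed.

(** Slacks are affine: the slack at a convex combination of points is the same combination of their
    slacks. This reduces convexity of a linear inequality with symbolic coefficients to a ring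
    identity. *)
Lemma convex_comb_le (R : realType) (t a b c d e f : R) :
  0 <= t <= 1 -> f - e = t * (b - a) + (1 - t) * (d - c) ->
  a <= b -> c <= d -> e <= f.
Proof.
move=> /andP[t0 t1] fe ab cd.
by rewrite -subr_ge0 fe addr_ge0// mulr_ge0// subr_ge0.
Qed.

Ltac conv_ineqs :=
  lazymatch goal with
  | |- _ /\ _ -> _ /\ _ -> _ /\ _ =>
      let h := fresh in let h' := fresh in
      let k := fresh in let k' := fresh in
      case=> h h' [k k']; split;
      [move: h k; clear h' k' | move: h' k'; clear h k]; conv_ineqs
  | |- _ => apply: convex_comb_le; [eassumption|ring]
  end.

Lemma facets12_convex (R : realType) (Cmin Cmax Vbar V : R)
  (t x1 x2 x3 y1 y2 y3 u2 u3 x1' x2' x3' y1' y2' y3' u2' u3' : R) :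
    0 <= t <= 1 -> facets12 Cmin Cmax Vbar V x1 x2 x3 y1 y2 y3 u2 u3 ->
    facets12 Cmin Cmax Vbar V x1' x2' x3' y1' y2' y3' u2' u3' ->
    facets12 Cmin Cmax Vbar V
      (t * x1 + (1 - t) * x1') (t * x2 + (1 - t) * x2')
      (t * x3 + (1 - t) * x3') (t * y1 + (1 - t) * y1')
      (t * y2 + (1 - t) * y2') (t * y3 + (1 - t) * y3')
      (t * u2 + (1 - t) * u2') (t * u3 + (1 - t) * u3').
Proof. by move=> t01; rewrite /facets12; conv_ineqs. Qed.

Lemma facets21_convex (R : realType) (Cmin Cmax Vbar V : R)
  (t x1 x2 x3 y1 y2 y3 u2 u3 x1' x2' x3' y1' y2' y3' u2' u3' : R) :
    0 <= t <= 1 -> facets21 Cmin Cmax Vbar V x1 x2 x3 y1 y2 y3 u2 u3 ->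
    facets21 Cmin Cmax Vbar V x1' x2' x3' y1' y2' y3' u2' u3' ->
    facets21 Cmin Cmax Vbar V
      (t * x1 + (1 - t) * x1') (t * x2 + (1 - t) * x2')
      (t * x3 + (1 - t) * x3') (t * y1 + (1 - t) * y1')
      (t * y2 + (1 - t) * y2') (t * y3 + (1 - t) * y3')
      (t * u2 + (1 - t) * u2') (t * u3 + (1 - t) * u3').
Proof. by move=> t01; rewrite /facets21; conv_ineqs. Qed.

(** * Validity of the inequalities at feasible schedules *)

Lemma dispatch_facets12 (R : realType) (Cmin Cmax Vbar V : R)
    (hCmin : 0 <= Cmin) (hCminVbar : Cmin <= Vbar) (hVbarCmax : Vbar <= Cmax)
    (hV : 0 < V) (hVbar : Vbar < Cmin + V)
    (hCmax1 : 0 <= Cmax - Vbar - V) (hCmax2 : 0 <= Cmax - Cmin - 2 * V)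
    (x1 x2 x3 y1 y2 y3 u2 u3 : R) :
  commitment y1 y2 y3 u2 u3 ->
  [/\ u2 <= y2, u3 <= y3 & u2 + u3 <= 1 - y1] ->
  dispatch Cmin Cmax Vbar V 1 x1 x2 x3 y1 y2 y3 ->
  facets12 Cmin Cmax Vbar V x1 x2 x3 y1 y2 y3 u2 u3.
Proof.
move=> [[y01 y02 y03 u02 u03] [s2 s3]] [ud1 ud2 ud3].
rewrite /dispatch /facets12 !mul1r.
move=> [[/andP[l1 h1] /andP[l2 h2] /andP[l3 h3]] [r12 r23 r21 r32]].
(* Of the 32 binary assignments, those that break a start-up or minimum up/down constraint are
   contradictory. For each of the others, every inequality is linear in x and the parameters. *)
case: y01 y02 y03 u02 u03 => [?|?] [?|?] [?|?] [?|?] [?|?]; subst;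
  try (exfalso; clear - s2 s3 ud1 ud2 ud3; lra);
  clear s2 s3 ud1 ud2 ud3;
  rewrite ?(mulr0, mulr1, subr0, subrr, addr0, add0r, sub0r)
    in l1 h1 l2 h2 l3 h3 r12 r23 r21 r32;
  do !split; lra.
Qed.

Lemma dispatch_facets21 (R : realType) (Cmin Cmax Vbar V : R)
    (hCmin : 0 <= Cmin) (hCminVbar : Cmin <= Vbar) (hVbarCmax : Vbar <= Cmax)
    (hV : 0 < V) (hVbar : Vbar < Cmin + V)
    (hCmax1 : 0 <= Cmax - Vbar - V) (hCmax2 : 0 <= Cmax - Cmin - 2 * V)
    (x1 x2 x3 y1 y2 y3 u2 u3 : R) :
  commitment y1 y2 y3 u2 u3 ->
  [/\ u2 + u3 <= y3, u2 <= 1 - y1 & u3 <= 1 - y2] ->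
  dispatch Cmin Cmax Vbar V 1 x1 x2 x3 y1 y2 y3 ->
  facets21 Cmin Cmax Vbar V x1 x2 x3 y1 y2 y3 u2 u3.
Proof.
move=> [[y01 y02 y03 u02 u03] [s2 s3]] [ud1 ud2 ud3].
rewrite /dispatch /facets21 !mul1r.
move=> [[/andP[l1 h1] /andP[l2 h2] /andP[l3 h3]] [r12 r23 r21 r32]].
case: y01 y02 y03 u02 u03 => [?|?] [?|?] [?|?] [?|?] [?|?]; subst;
  try (exfalso; clear - s2 s3 ud1 ud2 ud3; lra);
  clear s2 s3 ud1 ud2 ud3;
  rewrite ?(mulr0, mulr1, subr0, subrr, addr0, add0r, sub0r)
    in l1 h1 l2 h2 l3 h3 r12 r23 r21 r32;
  do !split; lra.
Qed.

(** * From the inequalities to the convex hull *)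

Lemma facets12_conv_hull (R : realType) (Cmin Cmax Vbar V : R)
    (hCmin : 0 <= Cmin) (hCminVbar : Cmin <= Vbar) (hVbarCmax : Vbar <= Cmax)
    (hV : 0 < V) (hVbar : Vbar < Cmin + V)
    (hCmax1 : 0 <= Cmax - Vbar - V) (hCmax2 : 0 <= Cmax - Cmin - 2 * V)
    (x1 x2 x3 y1 y2 y3 u2 u3 : R) :
  facets12 Cmin Cmax Vbar V x1 x2 x3 y1 y2 y3 u2 u3 ->
  conv_hull (P 3 1 2 Cmin Cmax Vbar V) (schedule x1 x2 x3 y1 y2 y3 u2 u3).
Proof.
move=> [[s2 [s3 [u20 u30]]] [[l1 [l2 l3]] [[up2 [up3 down]] H]]].
case: H => [h1 [h1' [h2 [h2' [h3 [h3' H]]]]]].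
case: H => [h21 [h21' [h32 [h12 [h23 [h23' [h31 [h31' [h13 h13']]]]]]]]].
(* The largest weight of 111 is the smaller of these two numbers. In the first case it exhausts
   [y2 - u2] and nothing is left for 110; in the second it exhausts [y3 - u3] and nothing is left
   for 011. *)
have [mn|nm] := leP (y2 - u2) (y3 - u3).
  have -> : schedule x1 x2 x3 y1 y2 y3 u2 u3 =
    let a := y2 - u2 in let b := 0 in let c := y1 - a in
    let d := y3 - u3 - a in let e := u2 - d in let f := u3 in
    schedule x1 x2 x3 (a + b + c) (a + b + d + e) (a + d + f) (d + e) f.
    by congr schedule; ring.
  have [a0 c0 d0 e0] : [/\ 0 <= y2 - u2, 0 <= y1 - (y2 - u2),
      0 <= y3 - u3 - (y2 - u2) & 0 <= u2 - (y3 - u3 - (y2 - u2))].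
    by clear - s2 s3 up2 mn; split; lra.
  (* The six weights add up to [y1 + u2 + u3]. *)
  apply: conv_hull12 => //; first by lra_from down.
  (* Where two inequalities bound the same form, the one that is exact for [b = 0] is used. The
     bound on [x1 - x2 + x3] is then the sum of those on [x1] and [x3 - x2]. *)
  apply: dispatch_decomposition => //;
    [ by lra_from l1 | by lra_from l2 | by lra_from l3
    | by lra_from h1 | by lra_from h2 | by lra_from h3'
    | by lra_from h12 | by lra_from h21' | by lra_from h32 | by lra_from h23'
    | by lra_from h13 | by lra_from h31' | by clear - h1 h32; lra ].
have -> : schedule x1 x2 x3 y1 y2 y3 u2 u3 =
  let a := y3 - u3 in let b := y2 - u2 - a in let c := y1 - (a + b) in
  let d := 0 in let e := u2 in let f := u3 in
  schedule x1 x2 x3 (a + b + c) (a + b + d + e) (a + d + f) (d + e) f.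
  by congr schedule; ring.
have [a0 b0 c0] : [/\ 0 <= y3 - u3, 0 <= y2 - u2 - (y3 - u3) &
    0 <= y1 - (y3 - u3 + (y2 - u2 - (y3 - u3)))].
  by clear - s2 up3 nm; split; lra.
apply: conv_hull12 => //; first by lra_from down.
(* Now [d = 0] selects the other inequality of each pair, and the bound on [x1 - x2 + x3] is the sum
   of those on [x3] and [x1 - x2]. *)
apply: dispatch_decomposition => //;
  [ by lra_from l1 | by lra_from l2 | by lra_from l3
  | by lra_from h1' | by lra_from h2' | by lra_from h3
  | by lra_from h12 | by lra_from h21 | by lra_from h32 | by lra_from h23
  | by lra_from h13' | by lra_from h31 | by clear - h3 h12; lra ].
Qed.

Lemma facets21_conv_hull (R : realType) (Cmin Cmax Vbar V : R)
    (hCmin : 0 <= Cmin) (hCminVbar : Cmin <= Vbar) (hVbarCmax : Vbar <= Cmax)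
    (hV : 0 < V) (hVbar : Vbar < Cmin + V)
    (hCmax1 : 0 <= Cmax - Vbar - V) (hCmax2 : 0 <= Cmax - Cmin - 2 * V)
    (x1 x2 x3 y1 y2 y3 u2 u3 : R) :
  facets21 Cmin Cmax Vbar V x1 x2 x3 y1 y2 y3 u2 u3 ->
  conv_hull (P 3 2 1 Cmin Cmax Vbar V) (schedule x1 x2 x3 y1 y2 y3 u2 u3).
Proof.
move=> [[up [down2 down3]] [[s2 [s3 [u20 u30]]] [[l1 [l2 l3]] H]]].
case: H => [h1 [h2 [h3 [h21 [h32 [h12 [h23 [h31 [h13 h123]]]]]]]]].
(* A start in period 2 now means 011, so [d = u2]. The weights [c] and [f] still include the weight
   of 101, which makes all five weights functions of y and u. *)
have -> : schedule x1 x2 x3 y1 y2 y3 u2 u3 =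
  let a := y3 - u3 - u2 in let b := y2 - u2 - a in let c := y1 - (a + b) in
  let d := u2 in let f := u3 in
  schedule x1 x2 x3 (a + b + c) (a + b + d) (a + d + f) d f.
  by congr schedule; ring.
have [a0 b0 c0] : [/\ 0 <= y3 - u3 - u2, 0 <= y2 - u2 - (y3 - u3 - u2) &
    0 <= y1 - (y3 - u3 - u2 + (y2 - u2 - (y3 - u3 - u2)))].
  by clear - up s2 s3; split; lra.
(* The two partial sums of weights equal [y1 + u2] and [y2 + u3]. *)
apply: conv_hull21 => //; [by lra_from down2 | by lra_from down3 | ].
(* Both [b] and [d] may be positive here, so the bound on [x1 - x2 + x3] comes from its own
   inequality in the system. *)
apply: dispatch_decomposition => //;
  [ by lra_from l1 | by lra_from l2 | by lra_from l3
  | by lra_from h1 | by lra_from h2 | by lra_from h3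
  | by lra_from h12 | by lra_from h21 | by lra_from h32 | by lra_from h23
  | by lra_from h13 | by lra_from h31 | by lra_from h123 ].
Qed.

(** * The descriptions of the two convex hulls *)

Theorem theorem4 (R : realType) (Cmin Cmax Vbar V : R)
    (hCmin : 0 <= Cmin) (hCminVbar : Cmin <= Vbar) (hVbarCmax : Vbar <= Cmax)
    (hV : 0 < V) (hVbar : Vbar < Cmin + V)
    (hCmax1 : 0 <= Cmax - Vbar - V) (hCmax2 : 0 <= Cmax - Cmin - 2 * V) :
  conv_hull (P 3 1 2 Cmin Cmax Vbar V) =
    [set p : xyu_space R 3 |
      let x1 := xc p 1 in let x2 := xc p 2 in let x3 := xc p 3 in
      let y1 := yc p 1 in let y2 := yc p 2 in let y3 := yc p 3 in
      let u2 := uc p 2 in let u3 := uc p 3 in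
      (y2 - y1 <= u2 /\ y3 - y2 <= u3 /\ 0 <= u2 /\ 0 <= u3)
      /\ (Cmin * y1 <= x1 /\ Cmin * y2 <= x2 /\ Cmin * y3 <= x3)
      /\ (u2 <= y2 /\ u3 <= y3 /\ y1 + u2 + u3 <= 1)
      /\ x1 <= Vbar * y1 + (Cmax - Vbar) * (y2 - u2)
      /\ x1 <= Vbar * y1 + V * (y2 - u2) + (Cmax - Vbar - V) * (y3 - u3)
      /\ x2 <= Cmax * y2 - (Cmax - Vbar) * u2
      /\ x2 <= Vbar * y2 + (Cmax - Vbar) * (y3 - u3)
      /\ x3 <= Cmax * y3 - (Cmax - Vbar) * u3
      /\ x3 <= (Vbar + V) * y3 - V * u3 + (Cmax - Vbar - V) * (y2 - u2)
      /\ x2 - x1 <= Vbar * y2 - Cmin * y1 + (Cmin + V - Vbar) * (y3 - u3)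
      /\ x2 - x1 <= (Cmin + V) * y2 - Cmin * y1 - (Cmin + V - Vbar) * u2
      /\ x3 - x2 <= (Cmin + V) * y3 - Cmin * y2 - (Cmin + V - Vbar) * u3
      /\ x1 - x2 <= Vbar * y1 - (Vbar - V) * y2 - (Cmin + V - Vbar) * u2
      /\ x2 - x3 <= Vbar * y2 - (Vbar - V) * y3 - (Cmin + V - Vbar) * u3
      /\ x2 - x3 <= (Cmin + V) * y2 - Cmin * y3 - (Cmin + V - Vbar) * u2
      /\ x3 - x1 <=
           (Cmin + 2 * V) * y3 - Cmin * y1 - (Cmin + 2 * V - Vbar) * u3
      /\ x3 - x1 <=
           (Vbar + V) * y3 - V * u3 - Cmin * y1 + (Cmin + V - Vbar) * (y2 - u2)
      /\ x1 - x3 <= Vbar * y1 - Cmin * y3 + (Cmin + 2 * V - Vbar) * (y2 - u2)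
      /\ x1 - x3 <=
           Vbar * y1 - Cmin * y3 + V * (y2 - u2)
           + (Cmin + V - Vbar) * (y3 - u3)]
  /\
  conv_hull (P 3 2 1 Cmin Cmax Vbar V) =
    [set p : xyu_space R 3 |
      let x1 := xc p 1 in let x2 := xc p 2 in let x3 := xc p 3 in
      let y1 := yc p 1 in let y2 := yc p 2 in let y3 := yc p 3 in
      let u2 := uc p 2 in let u3 := uc p 3 in
      (u2 + u3 <= y3 /\ y1 + u2 <= 1 /\ y2 + u3 <= 1)
      /\ (y2 - y1 <= u2 /\ y3 - y2 <= u3 /\ 0 <= u2 /\ 0 <= u3)
      /\ (Cmin * y1 <= x1 /\ Cmin * y2 <= x2 /\ Cmin * y3 <= x3)
      /\ x1 <= Vbar * y1 + V * (y2 - u2) + (Cmax - Vbar - V) * (y3 - u3 - u2)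
      /\ x2 <= Vbar * y2 + (Cmax - Vbar) * (y3 - u3 - u2)
      /\ x3 <= Cmax * y3 - (Cmax - Vbar) * u3 - (Cmax - Vbar - V) * u2
      /\ x2 - x1 <= Vbar * y2 - Cmin * y1 + (Cmin + V - Vbar) * (y3 - u3 - u2)
      /\ x3 - x2 <= (Cmin + V) * y3 - Cmin * y2 - (Cmin + V - Vbar) * u3
      /\ x1 - x2 <= Vbar * y1 - (Vbar - V) * y2 - (Cmin + V - Vbar) * u2
      /\ x2 - x3 <= Vbar * y2 - Cmin * y3 + (Cmin + V - Vbar) * (y3 - u3 - u2)
      /\ x3 - x1 <=
           (Cmin + 2 * V) * y3 - Cmin * y1 - (Cmin + 2 * V - Vbar) * u3
           - (Cmin + V - Vbar) * u2
      /\ x1 - x3 <=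
           Vbar * y1 - Cmin * y3 + V * (y2 - u2)
           + (Cmin + V - Vbar) * (y3 - u3 - u2)
      /\ x1 - x2 + x3 <=
           Vbar * y1 - (Vbar - V) * y2 + Vbar * y3
           + (Cmax - Vbar) * (y3 - u3 - u2)].
Proof.
split; apply/seteqP; split=> p.
(* The hull lies in every convex set containing [P], so the inequalities are checked only at
   feasible schedules. *)
- apply: (@conv_hull_sub R _ (facets12 Cmin Cmax Vbar V)).
    exact: facets12_convex.
  by move=> q /(P3E hCmin)[c /up_down12 ud d]; exact: dispatch_facets12.
- move=> Fp; rewrite -(scheduleK _ p).
  exact: facets12_conv_hull.
- apply: (@conv_hull_sub R _ (facets21 Cmin Cmax Vbar V)).
    exact: facets21_convex.
  by move=> q /(P3E hCmin)[c /up_down21 ud d]; exact: dispatch_facets21.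
- move=> Fp; rewrite -(scheduleK _ p).
  exact: facets21_conv_hull.
Qed.
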